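(* Let $(\mathfrak{g},\omega)$ be a symplectic Lie algebra. Then the left-symmetric product associated with $(\mathfrak{g},\omega)$ is Novikov if and only if it is associative.
   Context: A symplectic Lie algebra $(\mathfrak{g},\omega)$ is a finite-dimensional real Lie algebra $\mathfrak{g}$ with a skew-symmetric non-degenerate bilinear form $\omega$ such that $\omega([x,y],z)+\omega([y,z],x)+\omega([z,x],y)=0$ for all $x,y,z\in\mathfrak{g}$. The left-symmetric product associated with $(\mathfrak{g},\omega)$ is the bilinear product $(x,y)\mapsto x.y$ on $\mathfrak{g}$ defined by $\omega(x.y,z)=-\omega(y,[x,z])$ for all $x,y,z\in\mathfrak{g}$. It is known that this product satisfies $x.y-y.x=[x,y]$ and is left-symmetric, i.e. $(x.y).z-x.(y.z)=(y.x).z-y.(x.z)$ for all $x,y,z$. A left-symmetric product is called Novikov if $(x.y).z=(x.z).y$ for all $x,y,z\in\mathfrak{g}$; it is associative if $(x.y).z=x.(y.z)$ for all $x,y,z\in\mathfrak{g}$. *)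

(* Defs.v *)
From HB Require Import structures.
From mathcomp Require Import all_boot all_order all_algebra.
From mathcomp Require Import boolp reals.

Set Implicit Arguments.
Unset Strict Implicit.
Unset Printing Implicit Defensive.

Import GRing.Theory.
Local Open Scope ring_scope.

(* [{skew_symmetric U}] is the library's type of bilinear forms with
   [f x y = - f y x]; [nondegenerate f] says that the radical of [f] is 0. *)
Record symplecticLieAlgebra (R : realType) := SymplecticLieAlgebra {
  sla_sort :> vectType R;
  bracket : {bilinear sla_sort -> sla_sort -> sla_sort};
  omega : {skew_symmetric sla_sort};
  bracketxx : forall x, bracket x x = 0;
  jacobi : forall x y z,
    bracket x (bracket y z) + bracket y (bracket z x)
      + bracket z (bracket x y) = 0;
  omega_nondegenerate : nondegenerate omega;
  omega_cocycle : forall x y z,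
    omega (bracket x y) z + omega (bracket y z) x + omega (bracket z x) y = 0
}.

Arguments bracket {R s}.
Arguments omega {R s}.

Section LeftSymmetricProduct.
Variables (R : realType) (g : symplecticLieAlgebra R).
Implicit Types x y z u v : g.

Lemma omega_skew x y : omega x y = - omega y x.
Proof. by rewrite (hermitian_subproof x y) expr1 mulN1r. Qed.

Lemma omega_inj u v : (forall z, omega u z = omega v z) -> u = v.
Proof.
move=> uv; apply/eqP; rewrite -subr_eq0 -memv0.
rewrite -(eqP (omega_nondegenerate g)); apply/mem_orthovP => z _.
by rewrite linearBl /= uv subrr.
Qed.

Lemma omega_repr (f : {scalar g}) : exists u, forall z, omega u z = f z.
Proof.
pose b := vbasis (@fullv _ g).
pose n := \dim (@fullv _ g).
pose F (u : g) : 'rV[R]_n := \row_i omega u b`_i.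
have linF : linear F.
  by move=> a u v; apply/rowP=> i; rewrite !mxE linearPl.
pose LF : {linear g -> 'rV[R]_n} :=
  HB.pack F (GRing.isLinear.Build _ _ _ _ F linF).
have ext u (h : {scalar g}) :
    (forall i : 'I_n, omega u b`_i = h b`_i) -> forall z, omega u z = h z.
  move=> uh z; rewrite (coord_vbasis (memvf z)) !linear_sum /=.
  by apply: eq_bigr => i _; rewrite linearZr linearZ /= uh.
have kerF : lker (linfun LF) == 0%VS.
  apply/lker0P => u v; rewrite !lfunE /= => /rowP Fuv.
  apply: omega_inj => z; apply: ext => i.
  by have := Fuv i; rewrite !mxE.
have imF : limg (linfun LF) = fullv.
  apply/eqP; rewrite eqEdim subvf limg_dim_eq ?(eqP kerF) ?capv0 //.
  by rewrite [X in (X <= _)%N]dimvf /dim /= mul1n.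
have /memv_imgP [u _ fu] : (\row_i f b`_i : 'rV[R]_n) \in limg (linfun LF).
  by rewrite imF memvf.
exists u; apply: ext => i.
by have /rowP/(_ i) := fu; rewrite lfunE /= !mxE.
Qed.

Lemma lsprod_subproof x y :
  exists u, forall z, omega u z = - omega y (bracket x z).
Proof.
have lin : scalar (fun z => - omega y (bracket x z)).
  by move=> a u v /=; rewrite linearPr linearPr opprD mulrN.
exact: (omega_repr (HB.pack (fun z => - omega y (bracket x z))
          (GRing.isLinear.Build _ _ _ _ _ lin))).
Qed.

(* The unique product satisfying [lsprodE]; uniqueness is [omega_inj]. *)
Definition lsprod x y : g := sval (cid (lsprod_subproof x y)).

Lemma lsprodE x y z : omega (lsprod x y) z = - omega y (bracket x z).
Proof. exact: (svalP (cid (lsprod_subproof x y)) z). Qed.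

End LeftSymmetricProduct.

Arguments lsprod {R} g.

Definition left_symmetric (V : zmodType) (op : V -> V -> V) :=
  forall x y z,
    op (op x y) z - op x (op y z) = op (op y x) z - op y (op x z).

(* [right_commutative op] is [forall x y z, op (op x y) z = op (op x z) y]. *)
Definition novikov (V : zmodType) (op : V -> V -> V) :=
  left_symmetric op /\ right_commutative op.

Section LeftSymmetry.
Variables (R : realType) (g : symplecticLieAlgebra R).
Implicit Types x y z : g.

Lemma bracketC x y : bracket x y = - bracket y x.
Proof.
apply/eqP; rewrite -addr_eq0; apply/eqP.
have := bracketxx (x + y).
by rewrite linearDl !linearDr !bracketxx addr0 add0r.
Qed.

Lemma lsprod_comm x y : lsprod g x y - lsprod g y x = bracket x y.
Proof.
apply: omega_inj => z; rewrite linearBl /= !lsprodE opprK.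
have /eqP := omega_cocycle x y z.
rewrite -addrA addr_eq0 => /eqP ->.
rewrite [omega (bracket y z) x]omega_skew [omega (bracket z x) y]omega_skew.
by rewrite [bracket z x]bracketC linearNr opprK opprD opprK addrC.
Qed.

Lemma lsprod_left_symmetric : left_symmetric (lsprod g).
Proof.
move=> x y z; apply: omega_inj => t.
have jac : bracket (bracket x y) t =
    bracket x (bracket y t) - bracket y (bracket x t).
  have /eqP := jacobi x y t.
  rewrite [bracket t (bracket x y)]bracketC [bracket t x]bracketC linearNr /=.
  by rewrite subr_eq0 => /eqP.
have -> : lsprod g (lsprod g x y) z =
    lsprod g (lsprod g y x) z + lsprod g (bracket x y) z.
  apply: omega_inj => w; rewrite linearDl /= !lsprodE -(lsprod_comm x y).
  by rewrite linearBl /= linearBr /= opprB addKr.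
rewrite !linearBl linearDl /= !lsprodE jac linearBr /= !opprK opprB.
by rewrite addrA addrAC addrK.
Qed.

End LeftSymmetry.

(* Main.v *)
Require Import Defs.
From mathcomp Require Import all_boot all_order all_algebra.
From mathcomp Require Import reals.

(* Write L_x y = R_y x = x.y.  The omega-adjoint of L_x is -ad_x = R_x - L_x,
   hence R_x is self-adjoint.  If the product is associative, then
   R_(y.z) = R_z R_y, whose adjoint is R_(y.z) = R_y R_z, so right
   multiplications commute.  Conversely, a Novikov product satisfies
   L_(x.y) = R_y L_x; taking adjoints gives [R_y, L_x] = R_(x.y) - R_x R_y, which
   by left symmetry and right commutativity is -[R_y, L_x].  Hence
   [R_y, L_x] = 0, which is associativity. *)

Import GRing.Theory Num.Theory.
Local Open Scope ring_scope.

Section NovikovAssociative.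
Variables (R : realType) (g : symplecticLieAlgebra R).
Implicit Types x y z t : g.

Local Notation "x ** y" := (lsprod g x y) (at level 40, left associativity).

(** Both sides equal [omega x (bracket z y)]. *)
Lemma omega_lsprodr x y z : omega (y ** x) z = omega y (z ** x).
Proof.
by rewrite lsprodE bracketC linearNr opprK [RHS]omega_skew lsprodE opprK.
Qed.

Lemma omega_injr x y : (forall z, omega z x = omega z y) -> x = y.
Proof.
by move=> xy; apply: omega_inj => z; rewrite omega_skew xy -omega_skew.
Qed.

Lemma associative_right_commutative :
  associative (lsprod g) -> right_commutative (lsprod g).
Proof.
move=> assoc x y z; apply: omega_inj => t.
(* Both sides become [omega x (t ** y ** z)]: the left by moving [y ** z] across at once, the right
   by moving [y], then [z]. *)
by rewrite -assoc !omega_lsprodr assoc.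
Qed.

(** Up to sign, the adjoint of L_(x.y) = R_y L_x, applied to [t]. *)
Lemma right_commutative_adjoint x y t : right_commutative (lsprod g) ->
  bracket (x ** y) t = bracket x (t ** y).
Proof.
move=> rcomm; apply: omega_injr => z; apply: oppr_inj.
by rewrite -!lsprodE rcomm omega_lsprodr.
Qed.

Lemma right_commutative_associative :
  right_commutative (lsprod g) -> associative (lsprod g).
Proof.
move=> rcomm x t y; apply/esym/eqP; rewrite -subr_eq0.
have lsym := @lsprod_left_symmetric R g x t y.
have := right_commutative_adjoint x y t rcomm.
rewrite -!lsprod_comm (rcomm x y t) (rcomm t y x) => adj.
set a := (X in X == 0).
(* [adj] solved for [x ** t ** y] gives [a = t ** (x ** y) - t ** x ** y], which [lsym] identifies
   with [- a]. *)
have aN : a = - a.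
  by rewrite {2}/a lsym opprB /a (canRL (subrK _) adj) addrC -addrA addKr addrC.
suff: 2%:R *: a == 0 by rewrite scaler_eq0 pnatr_eq0.
by rewrite scaler_nat mulr2n {2}aN subrr.
Qed.

End NovikovAssociative.

Theorem theorem1 (R : realType) (g : symplecticLieAlgebra R) :
  novikov (lsprod g) <-> associative (lsprod g).
Proof.
split=> [[_ rcomm] | assoc]; first exact: right_commutative_associative.
split; first exact: lsprod_left_symmetric.
exact: associative_right_commutative.
Qed.
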